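(* Let $(X,X^+)$ be an ordered Banach space with total cone and let $T\in\mathcal{L}(X)$ be positive and quasi-compact. Then the following assertions are equivalent: (i) $\operatorname{r}(T) < 1$. (ii) The operator $\mathrm{id}-T: X\to X$ is bijective and $(\mathrm{id}-T)^{-1}$ is positive. (iii) Every $x\in X$ with $Tx \le x$ satisfies $x \ge 0$. (iv) (Small-gain condition) For each $0\neq x \in X^+$ we have $Tx \not\ge x$. (v) For each $x\in X^+$ we have $T^k x \to 0$ as $k\to\infty$. (vi) For each $x \in X^+$ we have $\inf_{k\ge0}\|T^k x\| = 0$.
   Context: An ordered Banach space $(X,X^+)$ is a real Banach space $X$ with a non-empty closed set $X^+$ such that $\alpha X^+ + \beta X^+\subseteq X^+$ for $\alpha,\beta\ge0$ and $X^+\cap(-X^+)=\{0\}$; $x\le y$ means $y-x\in X^+$, and $x\not\ge y$ means $x-y\notin X^+$. The cone is total if $X^+-X^+$ is dense in $X$. $T$ is positive if $TX^+\subseteq X^+$. $T$ is quasi-compact if there exist $n_0\in\mathbb{N}$ and a compact operator $K$ on $X$ with $\|T^{n_0}-K\|<1$ (equivalently, the essential spectral radius of $T$ is $<1$). $\operatorname{r}(T)$ is the spectral radius of (the complexification of) $T$. *)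

(* Defs.v *)
From HB Require Import structures.
From mathcomp Require Import all_boot all_order all_algebra.
From mathcomp Require Import all_classical all_reals all_analysis.
Set Implicit Arguments. Unset Strict Implicit. Unset Printing Implicit Defensive.
Import Order.TTheory GRing.Theory Num.Theory.
Import numFieldNormedType.Exports.
Local Open Scope classical_set_scope.
Local Open Scope ring_scope.

Section Defs.
Context {R : realType} {X : normedModType R}.

Definition is_cone (C : set X) : Prop :=
  [/\ C !=set0, closed C,
      (forall (a b : R) (x y : X), 0 <= a -> 0 <= b -> C x -> C y -> C (a *: x + b *: y))
    & (forall x : X, C x -> C (- x) -> x = 0)].

Definition total_cone (C : set X) : Prop :=
  closure [set x - y | x in C & y in C] = setT.

Definition positive_op (C : set X) (T : X -> X) : Prop :=
  forall x, C x -> C (T x).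

Definition compact_op (K : X -> X) : Prop :=
  compact (closure (K @` ball (0 : X) 1)).

Definition opnorm_lt1 (A : X -> X) : Prop :=
  exists2 c : R, c < 1 & forall x, `|A x| <= c * `|x|.

Definition quasi_compact (T : X -> X) : Prop :=
  exists n0 : nat, exists K : {linear X -> X},
    (0 < n0)%N /\ compact_op K /\ opnorm_lt1 (fun x => iter n0 T x - K x).

(* Spectrum of the complexification T_C of T on X + iX:
   lambda = a + i b lies in the spectrum iff lambda - T_C is not bijective,
   where (lambda - T_C)(x + i y) = (a x - b y - T x) + i (b x + a y - T y). *)
Definition in_spectrumC (T : X -> X) (a b : R) : Prop :=
  ~ bijective (fun p : X * X =>
      (a *: p.1 - b *: p.2 - T p.1, b *: p.1 + a *: p.2 - T p.2)).

Definition spectral_radius (T : X -> X) : R :=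
  sup [set r : R | exists a b : R, in_spectrumC T a b /\ r = Num.sqrt (a ^+ 2 + b ^+ 2)].

End Defs.

(* Main.v *)
Require Import Defs.
From HB Require Import structures.
From mathcomp Require Import all_boot all_order all_algebra.
From mathcomp Require Import all_classical all_reals all_analysis.
From mathcomp Require Import ring lra zify.
Import Order.TTheory GRing.Theory Num.Theory.
Import numFieldNormedType.Exports.
Local Open Scope classical_set_scope.
Local Open Scope ring_scope.

(** The heart is (iv) => [||T ^ N|| < 1] for some [N].  Suppose [a k = ||T ^ k||]
    is at least 1 for all [k].  For [t > 1] close to 1 pick [k] such that
    [a k * t ^ k] is large and maximal among the indices up to [k], so that
    [a (k - m) <= a k * t ^ m].  Write [T ^ n = K + A] with [K] compact and
    [||A|| <= q < 1].  Near-maximizers [z] of [T ^ k] satisfy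
    [||T ^ (k - n) (K z)|| >= c a k]; by compactness [K z] may be replaced by a
    fixed vector, and by totality of the cone by a fixed [u >= 0].  As [t]
    decreases to 1, [T ^ (k - n) u / a k] converges along an ultrafilter to some
    [w >= 0], [w <> 0].  With [s = 1 / t], the vectors
    [x = sum_(i <= k - n) s ^ (k - n - i) T ^ i u / a k] dominate
    [T ^ (k - n) u / a k] and [T x - s x] tends to [T w].  After division by
    [1 + ||x||] quasi-compactness makes them converge, and the limit [l] is a
    nonzero element of the cone with [T l >= l], which contradicts (iv).

    For (i) => (ii), [r - T] is injective for real [r >= 1], hence bounded below
    uniformly in [r] by quasi-compactness; this propagates positive
    invertibility of [r - T] from large [r] down to [r = 1] in steps of fixed
    length.  No holomorphic functional calculus is needed. *)

(* Provides the pointed topological structures on products. *)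
HB.saturate prod.

(** * Completeness of products and fixed points in closed sets *)

Lemma prod_complete (R : realType) (U V : completeNormedModType R)
    (F : set_system (U * V)) :
  ProperFilter F -> cauchy F -> cvg F.
Proof.
move=> FF /cauchyP Fc; apply/cvg_ex.
have c1 : cvg (fst @ F).
  apply: cauchy_cvg; apply/cauchyP => e e0.
  have [x Fx] := Fc e e0; exists x.1.
  rewrite -[_ (ball _ _)]/(F [set p | ball x.1 e p.1]).
  by apply: filterS Fx => p [].
have c2 : cvg (snd @ F).
  apply: cauchy_cvg; apply/cauchyP => e e0.
  have [x Fx] := Fc e e0; exists x.2.
  rewrite -[_ (ball _ _)]/(F [set p | ball x.2 e p.2]).
  by apply: filterS Fx => p [].
exists (lim (fst @ F), lim (snd @ F)).
move=> A /(cvg_pair c1 c2); rewrite -[_ A]/(F [set p | A (p.1, p.2)]).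
by apply: filterS => -[].
Qed.

HB.instance Definition _ (R : realType) (U V : completeNormedModType R) :=
  Uniform_isComplete.Build (U * V)%type (@prod_complete R U V).

Lemma banach_fixed_point_in {R : realType} {V : completeNormedModType R}
    (D : set V) (F : V -> V) (c : R) :
  closed D -> D !=set0 -> (forall x, D x -> D (F x)) -> c < 1 ->
  (forall x y, `|F x - F y| <= c * `|x - y|) -> exists2 x, D x & F x = x.
Proof.
move=> cD D0 FD c1 Fc.
pose f : {fun D >-> D} := mkfun_fun FD.
suff fc : is_contraction f.
  by have [p Dp pE] := banach_fixed_point fc cD D0; exists p.
have m0 : 0 <= Num.max c 0 by rewrite le_max lexx orbT.
exists (NngNum m0); split => /=; first by rewrite gt_max c1 ltr01.
move=> [x y] _ /=; apply: le_trans (Fc x y) _.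
by apply: ler_wpM2r => //; rewrite le_max lexx.
Qed.

(** * Inverting [id - L] when a power of [L] is a contraction *)

Section power_contraction.
Context {R : realType} {V : completeNormedModType R}.
Variables (L : {linear V -> V}) (N : nat) (c : R).
Hypotheses (c1 : c < 1) (LN : forall x, `|iter N L x| <= c * `|x|).

Let iterB k x y : iter k L (x - y) = iter k L x - iter k L y.
Proof. by elim: k => //= k ->; rewrite linearB. Qed.

Let iterD k x y : iter k L (x + y) = iter k L x + iter k L y.
Proof. by elim: k => //= k ->; rewrite linearD. Qed.

Let fix_eq x y q : x = q + iter N L x -> y = q + iter N L y -> x = y.
Proof.
move=> xE yE; apply/eqP; rewrite -subr_eq0 -normr_eq0; apply/eqP.
have := LN (x - y); rewrite iterB.
have -> : iter N L x - iter N L y = x - y.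
  by rewrite {2}xE {2}yE opprD addrACA subrr add0r.
move=> le_c; apply/eqP; rewrite eq_le normr_ge0 andbT leNgt.
by apply/negP => gt0; move: le_c; rewrite leNgt gtr_pMl// c1.
Qed.

(** Iterating [x = q + L x] gives [x = Q + L^N x], with [Q] the sum of [L^i q] over [i < N]; this
    equation has exactly one solution by contraction. *)
Lemma sub_id_bijective : bijective (fun x => x - L x).
Proof.
have fixN k x q : x = q + L x -> x = (\sum_(i < k) iter i L q) + iter k L x.
  move=> xE; elim: k => [|k IH]; first by rewrite big_ord0 add0r.
  by rewrite big_ord_recr /= -addrA -iterS iterSr -iterD -xE.
have inj x y : x - L x = y - L y -> x = y.
  move=> xy; apply: (@fix_eq x y (\sum_(i < N) iter i L (x - L x))).
    by apply: fixN; rewrite subrK.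
  by apply: fixN; rewrite xy subrK.
have ex q : exists x, x - L x = q.
  pose Q := \sum_(i < N) iter i L q.
  have [|||x y|x _ xE] :=
      @banach_fixed_point_in R V setT (fun x => Q + iter N L x) c closedT.
  - by exists 0.
  - by [].
  - exact: c1.
  - by rewrite opprD addrACA subrr add0r -iterB.
  exists x; apply/eqP; rewrite subr_eq; apply/eqP.
  (* The vector [q + L x] solves the same [N]-step equation as [x], so the two agree. *)
  apply: (@fix_eq _ _ Q); first by rewrite xE.
  rewrite iterD -[in RHS]iterSr iterS -{1}xE linearD.
  have QE : \sum_(i < N.+1) iter i L q = q + L Q.
    by rewrite big_ord_recl linear_sum.
  by rewrite !addrA -QE big_ord_recr.
have [S SE] := choice ex.
by exists S => x; [apply: inj; rewrite SE|].
Qed.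

End power_contraction.

(** * Spectrum of the complexification *)

Section complexification.
Context {R : realType} {X : normedModType R}.

(* Multiplication by [a + i b] on [X + i X]. *)
Definition cscale (a b : R) (p : X * X) : X * X :=
  (a *: p.1 - b *: p.2, b *: p.1 + a *: p.2).

Lemma cscale_is_linear a b : linear (cscale a b).
Proof.
move=> k p q; apply: injective_projections; rewrite /= !scalerDr !scalerA.
- by rewrite opprD addrACA [a * k]mulrC [b * k]mulrC scalerN scalerA.
- by rewrite addrACA [a * k]mulrC [b * k]mulrC.
Qed.

HB.instance Definition _ a b := GRing.isLinear.Build R (X * X)%type (X * X)%type
  *:%R (cscale a b) (cscale_is_linear a b).

Lemma cscale_comp a b a' b' p :
  cscale a b (cscale a' b' p) = cscale (a * a' - b * b') (a * b' + b * a') p.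
Proof.
rewrite /cscale /= !(scalerBr, scalerDr) !scalerA !scalerDl !scaleNr !opprD.
rewrite addrACA; congr (_, _).
by rewrite addrACA; congr (_ + _); rewrite addrC.
Qed.

Lemma cscale1 p : cscale 1 0 p = p.
Proof. by case: p => x y; rewrite /cscale /= !scale1r !scale0r subr0 add0r. Qed.

(** [X * X] carries the maximum norm, which complex scalars of modulus 1 need not preserve; the
    factor 2 is a crude bound. *)
Lemma ler_norm_cscale a b m p :
  0 <= m -> a ^+ 2 + b ^+ 2 = m ^+ 2 -> `|cscale a b p| <= 2 * m * `|p|.
Proof.
move=> m0 abm.
have am : `|a| <= m.
  by rewrite -(@ler_pXn2r _ 2) ?nnegrE // -normrX ger0_norm ?sqr_ge0 // -abm
     lerDl sqr_ge0.
have bm : `|b| <= m.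
  by rewrite -(@ler_pXn2r _ 2) ?nnegrE // -normrX ger0_norm ?sqr_ge0 // -abm
     lerDr sqr_ge0.
have p1 : `|p.1| <= `|p| by rewrite prod_normE le_max lexx.
have p2 : `|p.2| <= `|p| by rewrite prod_normE le_max lexx orbT.
have H k x : `|k| <= m -> `|x| <= `|p| -> `|k *: x| <= m * `|p|.
  by move=> *; rewrite normrZ ler_pM.
rewrite [in leLHS]prod_normE /= ge_max -mulrA mulr2n mulrDl mul1r.
by rewrite (le_trans (ler_normB _ _)) ?(le_trans (ler_normD _ _)) ?lerD ?H.
Qed.

Definition cmap (T : X -> X) (p : X * X) : X * X := (T p.1, T p.2).

Lemma cmap_is_linear (T : {linear X -> X}) : linear (cmap T).
Proof. by move=> k p q; rewrite /cmap /= !linearP. Qed.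

HB.instance Definition _ (T : {linear X -> X}) :=
  GRing.isLinear.Build R (X * X)%type (X * X)%type *:%R (cmap T)
    (cmap_is_linear T).

Lemma cmap_cscale (T : {linear X -> X}) a b p :
  cmap T (cscale a b p) = cscale a b (cmap T p).
Proof. by rewrite /cmap /cscale /= !(linearB, linearD) !linearZ. Qed.

(** Complex scalars commute with [cmap T], so they collect into one scalar and the factor 2 of
    [ler_norm_cscale] is paid only once. *)
Lemma iter_cscale_cmap (T : {linear X -> X}) a b m k :
  a ^+ 2 + b ^+ 2 = m ^+ 2 -> exists a' b',
    a' ^+ 2 + b' ^+ 2 = (m ^+ k) ^+ 2 /\
    forall p, iter k (cscale a b \o cmap T) p = cscale a' b' (cmap (iter k T) p).
Proof.
move=> abm; elim: k => [|k [a' [b' [abE IH]]]].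
  exists 1, 0; rewrite expr0 !expr1n expr0n addr0; split=> //.
  by move=> p; rewrite cscale1; case: p.
exists (a * a' - b * b'), (a * b' + b * a'); split.
  by rewrite (exprS m k) (exprMn _ m) -abE -abm; ring.
by move=> p; rewrite iterS IH /= cmap_cscale cscale_comp.
Qed.

End complexification.

(** With [lambda = a + i b] and [L = lambda^-1 T_C], one has [lambda - T_C = lambda (id - L)]; the
    bound [2 c / r^N < 1] for [L^N] makes [id - L] bijective. *)
Lemma norm_iter_notin_spectrumC (R : realType) (X : completeNormedModType R)
    (T : {linear X -> X}) (N : nat) (c a b : R) :
  (0 < N)%N -> (forall x, `|iter N T x| <= c * `|x|) ->
  0 <= c -> 2 * c < Num.sqrt (a ^+ 2 + b ^+ 2) ^+ N -> ~ in_spectrumC T a b.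
Proof.
move=> N0 TN c0; set r := Num.sqrt _ => cr; apply; rewrite -/r in cr.
have d0 : 0 <= a ^+ 2 + b ^+ 2 by rewrite addr_ge0 ?sqr_ge0.
have rE : a ^+ 2 + b ^+ 2 = r ^+ 2 by rewrite sqr_sqrtr.
have r0 : 0 < r.
  rewrite lt_neqAle sqrtr_ge0 andbT eq_sym; apply/eqP => r0.
  by move: cr; rewrite r0 expr0n eqn0Ngt N0 /= ltNge mulr_ge0.
have rN0 : 0 < r ^+ N by rewrite exprn_gt0.
have rn0 : r != 0 by rewrite gt_eqF.
have inv (e f : R) : e ^+ 2 + f ^+ 2 = r ^+ 2 ->
    cancel (@cscale R X e f) (cscale (e / r ^+ 2) (- f / r ^+ 2)).
  move=> ef p; rewrite cscale_comp -[RHS]cscale1; congr (cscale _ _ p).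
    have -> : e / r ^+ 2 * e - - f / r ^+ 2 * f =
              (e ^+ 2 + f ^+ 2) / r ^+ 2 by ring.
    by rewrite ef divff // expf_neq0.
  by ring.
pose L := @cscale R X (a / r ^+ 2) (- b / r ^+ 2) \o cmap T.
have LN p : `|iter N L p| <= (2 * (r^-1 ^+ N) * c) * `|p|.
  have [|a' [b' [abE ->]]] :=
      @iter_cscale_cmap R X T (a / r ^+ 2) (- b / r ^+ 2) (r^-1) N.
    have -> : (a / r ^+ 2) ^+ 2 + (- b / r ^+ 2) ^+ 2 =
      (a ^+ 2 + b ^+ 2) * (r ^+ 2)^-1 * (r ^+ 2)^-1 by ring.
    by rewrite rE mulfV ?expf_neq0 // mul1r exprVn.
  have rV0 : 0 <= r^-1 ^+ N by rewrite exprn_ge0 // invr_ge0 ltW.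
  apply: le_trans (ler_norm_cscale _ _ _ _ rV0 abE) _.
  rewrite -[leRHS]mulrA ler_wpM2l //; first by rewrite mulr_ge0.
  rewrite [in leLHS]prod_normE ge_max /= !(le_trans (TN _)) // ler_wpM2l //.
    by rewrite prod_normE le_max lexx orbT.
  by rewrite prod_normE le_max lexx.
have c1 : 2 * (r^-1 ^+ N) * c < 1.
  by rewrite mulrAC exprVn ltr_pdivrMr // mul1r.
have [g g1 g2] := sub_id_bijective _ _ _ c1 LN.
have invr : cancel (cscale (a / r ^+ 2) (- b / r ^+ 2)) (@cscale R X a b).
  move=> p; have := inv a (- b); rewrite sqrrN opprK => /(_ rE p) {2}<-.
  rewrite !cscale_comp; congr (cscale _ _ p); ring.
have bij := bij_comp (Bijective (inv _ _ rE) invr) (Bijective g1 g2).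
apply: (eq_bij bij) => p /=.
by rewrite linearB /= /L /= invr.
Qed.

(** * Limits along ultrafilters *)

Section ultrafilter_limits.
Context {R : realType} {X : completeNormedModType R} {I : Type}.
Variables (U : set_system I) (UU : UltraFilter U).
Let UP : ProperFilter U := ultra_proper.
#[local] Existing Instance UP.

(** One ultrafilter replaces repeated passing to subsequences: it yields limits for all the nets at
    once. *)
Lemma ultra_compact_cvg (V : topologicalType) (A : set V) (f : I -> V) :
  compact A -> (\forall i \near U, A (f i)) -> exists l : V, f @ U --> l.
Proof.
rewrite compact_ultra => Ac fA.
have fU : UltraFilter (f @ U).
  split=> [|G GP fG]; first exact: fmap_proper_filter.
  rewrite eqEsubset; split => // B GB.
  have [//|UB] := in_ultra_setVsetC (f @^-1` B) UU.
  have : G (B `&` ~` B) by apply: filterI => //; exact: (fG (~` B)).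
  by rewrite setICr => /(@filter_not_empty _ G).
by have [l [_ lP]] := Ac _ fU fA; exists l.
Qed.

Lemma cvg_of_small_diameter (f : I -> X) :
  (forall e : R, 0 < e -> exists2 A, U A &
     forall i j, A i -> A j -> `|f i - f j| <= e) ->
  exists l : X, f @ U --> l.
Proof.
move=> H; apply/cvg_ex; apply: cauchy_cvg; apply/cauchyP => e e0.
have [|A UA HA] := H (e / 2); first by rewrite divr_gt0.
have [i Ai] := filter_ex UA.
exists (f i); rewrite -[_ (ball _ _)]/(U [set j | ball (f i) e (f j)]).
apply: filterS UA => j Aj; rewrite -ball_normE /ball_ /=.
by apply: le_lt_trans (HA _ _ Ai Aj) _; rewrite ltr_pdivrMr// ltr_pMr// ltr1n.
Qed.

Lemma small_diameter_of_cvg (f : I -> X) (l : X) (e : R) :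
  f @ U --> l -> 0 < e ->
  exists2 A, U A & forall i j, A i -> A j -> `|f i - f j| <= e.
Proof.
move=> fl e0; have e2 : 0 < e / 2 by rewrite divr_gt0.
exists [set i | `|l - f i| <= e / 2].
  by move/cvgrPdist_le: fl; exact.
move=> i j /= li lj; rewrite -(subrKA l) [e]splitr.
by rewrite (le_trans (ler_normD _ _)) // lerD // distrC.
Qed.

Lemma compact_op_cvg (K : {linear X -> X}) (f : I -> X) (B : R) :
  compact_op K -> (\forall i \near U, `|f i| <= B) ->
  exists l : X, (K \o f) @ U --> l.
Proof.
move=> Kc fB.
pose M := `|B| + 1.
have M0 : 0 < M by rewrite ltr_wpDl.
have [|l Hl] := @ultra_compact_cvg X _ (fun i => K (M^-1 *: f i)) Kc.
  apply: filterS fB => i fB; apply: subset_closure; exists (M^-1 *: f i) => //.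
  rewrite -ball_normE /ball_ /= sub0r normrN normrZ gtr0_norm ?invr_gt0 //.
  rewrite mulrC ltr_pdivrMr // mul1r (le_lt_trans fB) // /M.
  by rewrite (le_lt_trans (ler_norm B)) // ltrDl.
exists (M *: l).
rewrite (_ : K \o f = fun i => M *: K (M^-1 *: f i)).
  by apply: cvgZl_tmp.
by apply/funext => i /=; rewrite linearZ scalerA mulfV ?scale1r // gt_eqF.
Qed.

End ultrafilter_limits.

(** * Indices at which a sequence reaches a record *)

(** The least index where [c] exceeds [B] is a record, since earlier values are at most [B]; as [B]
    bounds the first [L] values, this index is at least [L]. *)
Lemma exists_record {R : realType} (c : nat -> R) (L : nat) :
  (forall B, exists k, B < c k) ->
  exists k, [/\ (L <= k)%N, L%:R <= c k & forall i, (i <= k)%N -> c i <= c k].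
Proof.
move=> unb; pose B := L%:R + \sum_(i < L) `|c i|.
have exB : exists k, B < c k by exact: unb.
case: (ex_minnP exB) => k Bk kmin; exists k.
have S0 : 0 <= \sum_(i < L) `|c i| by apply: sumr_ge0.
split.
- rewrite leqNgt; apply/negP => kL.
  have : c k <= B.
    rewrite /B (bigD1 (Ordinal kL)) //= addrCA.
    rewrite (le_trans (ler_norm _)) // lerDl addr_ge0 //.
    exact: sumr_ge0.
  by rewrite leNgt Bk.
- by rewrite (le_trans _ (ltW Bk)) // /B lerDl.
- move=> i; rewrite leq_eqVlt => /predU1P[->//|ik].
  have /negP : ~ (B < c i) by move=> /kmin; rewrite leqNgt ik.
  by rewrite -leNgt => /le_trans -> //; exact: ltW.
Qed.

Lemma bernoulli_ineq {R : realType} (x : R) k :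
  -1 <= x -> 1 + x *+ k <= (1 + x) ^+ k.
Proof.
rewrite -subr_ge0 opprK addrC => x1.
elim: k => [|k IH]; first by rewrite mulr0n addr0.
rewrite exprS (le_trans _ (ler_wpM2l x1 IH)) // mulrDl mul1r mulrDr mulr1 mulrS.
rewrite -!addrA lerD2l addrCA lerD2l lerDl mulrnAr -expr2.
by rewrite mulrn_wge0 // sqr_ge0.
Qed.

(** The record is taken for [a k * t ^ k], unbounded by Bernoulli and [a k >= 1]; dividing the
    record inequality at [k - m] by [t ^ (k - m)] gives the last bound. *)
Lemma exists_growth_index {R : realType} (a : nat -> R) (j : nat) :
  (forall k, 1 <= a k) ->
  exists k, [/\ (j <= k)%N, j.+1%:R <= a k * (1 + j.+1%:R^-1) ^+ k
    & forall m, (m <= k)%N -> a (k - m)%N <= a k * (1 + j.+1%:R^-1) ^+ m].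
Proof.
move=> a1; set t := 1 + _.
have j0 : 0 < j.+1%:R^-1 :> R by rewrite invr_gt0.
have t0 : 0 < t by rewrite addr_gt0.
have unb B : exists k, B < a k * t ^+ k.
  exists (Num.truncn (B / j.+1%:R^-1)).+1; set k := _.+1.
  have : 1 * t ^+ k <= a k * t ^+ k by rewrite ler_wpM2r // exprn_ge0 // ltW.
  apply: lt_le_trans; rewrite mul1r.
  apply: lt_le_trans (bernoulli_ineq _ _ (le_trans (lerN10 R) (ltW j0))).
  rewrite ltr_wpDl // -[X in _ < X]mulr_natl -ltr_pdivrMr //; exact: truncnS_gt.
have [k [jk ck kmax]] := exists_record (fun k => a k * t ^+ k) j.+1 unb.
exists k; split => //; first exact: ltnW.
move=> m mk; have := kmax (k - m)%N (leq_subr _ _).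
by rewrite -[in t ^+ k](subnK mk) exprD mulrCA mulrC ler_pM2l // exprn_gt0.
Qed.

(** * Quasi-compact operators *)

Lemma continuous_linear_norm_le (R : realType) (X : normedModType R)
    (T : {linear X -> X}) :
  continuous T -> exists2 M : R, 0 < M & forall x, `|T x| <= M * `|x|.
Proof.
move=> /(_ 0) Tc.
have /linear_boundedP [M [Mr HM]] := continuous_linear_bounded 0 Tc.
exists (`|M| + 1); first by rewrite ltr_wpDl.
apply: HM.
by rewrite (le_lt_trans (ler_norm M)) // ltrDl.
Qed.

Lemma cvg_scale_bounded0 (R : realType) (X : normedModType R) (I : Type)
    (F : set_system I) (FF : Filter F) (s : I -> R) (x : I -> X) (B : R) :
  s @ F --> 0 -> (\forall i \near F, `|x i| <= B) ->
  (fun i => s i *: x i) @ F --> (0 : X).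
Proof.
move=> s0 xB; pose M := `|B| + 1.
have M0 : 0 < M by rewrite ltr_wpDl.
apply/cvgrPdist_le => e e0.
have H : \forall i \near F, `|0 - s i| <= e / M.
  by move/cvgrPdist_le: s0; apply; rewrite divr_gt0.
apply: filterS2 xB H => i xB; rewrite !sub0r !normrN normrZ => sM.
rewrite -(divfK (lt0r_neq0 M0) e) ler_pM // (le_trans xB) // /M.
by rewrite (le_trans (ler_norm B)) // lerDl.
Qed.

Section quasi_compact_operator.
Context {R : realType} {X : completeNormedModType R}.
Variables (T : {linear X -> X}) (n : nat) (K : {linear X -> X}) (q : R).
Hypotheses (Tc : continuous T) (Kc : compact_op K) (q0 : 0 <= q) (q1 : q < 1).
Hypothesis Aq : forall x, `|iter n T x - K x| <= q * `|x|.

Lemma iter_linearB k x y : iter k T (x - y) = iter k T x - iter k T y.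
Proof. by elim: k => //= k ->; rewrite linearB. Qed.

Lemma iter_linearZ k a x : iter k T (a *: x) = a *: iter k T x.
Proof. by elim: k => //= k ->; rewrite linearZ. Qed.

Section ultrafilter.
Variables (I : Type) (U : set_system I) (UU : UltraFilter U).
Let UP : ProperFilter U := ultra_proper.
#[local] Existing Instance UP.

(* On bounded nets the compact part of [T ^ n] converges along [U], and the
   rest is a strict contraction compared with [r ^ n]. *)
Lemma approx_eigenvector_cvg (x : I -> X) (s : I -> R) (r B : R) (b : X) :
  1 <= r -> s @ U --> r -> (\forall i \near U, `|x i| <= B) ->
  (fun i => T (x i) - s i *: x i) @ U --> b -> exists l : X, x @ U --> l.
Proof.
move=> r1 sr xB Txb.
have c1 : (fun i => T (x i) - r *: x i) @ U --> b.
  rewrite (_ : (fun i => _) =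
    fun i => (T (x i) - s i *: x i) + (s i - r) *: x i); last first.
    by apply/funext => i; rewrite scalerBl addrA subrK.
  rewrite -[b]addr0; apply: cvgD => //.
  apply: cvg_scale_bounded0 xB.
  by rewrite -(subrr r); apply: cvgB => //; exact: cvg_cst.
(* Convergence of [T x - r x] passes by induction to [T ^ k x - r ^ k x]; the case [k = n] is the
   one needed. *)
have ck k : exists bk : X, (fun i => iter k T (x i) - r ^+ k *: x i) @ U --> bk.
  elim: k => [|k [bk IH]].
    exists 0; rewrite (_ : (fun i => _) = cst 0); first exact: cvg_cst.
    by apply/funext => i /=; rewrite expr0 scale1r subrr.
  exists (T bk + r ^+ k *: b).
  rewrite (_ : (fun i => _) = fun i => T (iter k T (x i) - r ^+ k *: x i) +
                                 r ^+ k *: (T (x i) - r *: x i)); last first.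
    apply/funext => i; rewrite linearB scalerBr [T (_ *: _)]linearZ /= subrKA.
    by rewrite scalerA -exprSr.
  apply: cvgD; last exact: cvgZl_tmp.
  exact: (cvg_comp _ _ IH (Tc bk)).
have [bn cn] := ck n.
have [k Kx] := compact_op_cvg U UU K x B Kc xB.
apply: cvg_of_small_diameter => e e0.
have [|A UA HA] := small_diameter_of_cvg _ _ _ _ (e * (1 - q)) (cvgB cn Kx).
  by rewrite mulr_gt0 // subr_gt0.
exists A => // i j Ai Aj; have := HA i j Ai Aj; rewrite /= => le_e.
set d := x i - x j.
pose g y := iter n T y - r ^+ n *: y - K y.
have gd : g (x i) - g (x j) = g d.
  rewrite /g /d iter_linearB [K (_ - _)]linearB scalerBr.
  rewrite opprD addrACA -[- K _ - _]opprD; congr (_ - _).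
  by rewrite opprD addrACA -[- (_ *: x i) - _]opprD.
(* On [A] the convergent expression [g] varies by at most [e (1 - q)]. Since [r ^ n >= 1], this
   yields [|d| <= q |d| + e (1 - q)], hence [|d| <= e]. *)
have rd : r ^+ n *: d = (iter n T d - K d) - (g (x i) - g (x j)).
  by rewrite gd /g [X in _ = _ - X]addrAC subKr.
have le1 : `|d| <= `|r ^+ n *: d|.
  by rewrite normrZ ler_peMl // normrX exprn_ege1 // (le_trans r1) // ler_norm.
have dq : `|d| <= q * `|d| + e * (1 - q).
  rewrite (le_trans le1) // rd (le_trans (ler_normB _ _)) // lerD //.
have q1' : 0 < 1 - q by rewrite subr_gt0.
by rewrite -(ler_pM2r q1'); lra.
Qed.

(** As [K] makes [w m.+1] converge, passing from [w m.+1] to [w m] multiplies diameters by [q] up to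
    a small error. Starting [p] steps further back gives [2 B q ^ p], with [p] arbitrary. *)
Lemma backward_orbit_cvg (w : nat -> I -> X) (B : R) :
  (forall m, \forall i \near U, `|w m i| <= B) ->
  (forall m, \forall i \near U, w m i = iter n T (w m.+1 i)) ->
  forall m, exists l : X, w m @ U --> l.
Proof.
move=> wB wT.
have diam p : forall m e, 0 < e -> exists2 A, U A &
    forall i j, A i -> A j -> `|w m i - w m j| <= 2 * B * q ^+ p + e.
  elim: p => [|p IH] m e e0.
    exists [set i | `|w m i| <= B]; first exact: wB.
    move=> i j /= wi wj; rewrite expr0 mulr1.
    by apply: le_trans (ler_normB _ _) _; lra.
  have e2 : 0 < e / 2 by rewrite divr_gt0.
  have [A UA HA] := IH m.+1 _ e2.
  have [k Kw] := compact_op_cvg U UU K (w m.+1) B Kc (wB m.+1).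
  have [A' UA' HA'] := small_diameter_of_cvg _ _ _ _ _ Kw e2.
  exists (A `&` A' `&` [set i | w m i = iter n T (w m.+1 i)]).
    by apply: filterI; [exact: filterI|exact: wT].
  move=> i j [[Ai A'i] wi] [[Aj A'j] wj]; rewrite wi wj.
  set y := w m.+1; rewrite -iter_linearB -(subrK (K (y i - y j)) (iter n T _)).
  rewrite (le_trans (ler_normD _ _)) // linearB.
  have := HA _ _ Ai Aj; have := HA' _ _ A'i A'j; have := Aq (y i - y j).
  rewrite -/y /= linearB exprS => le1 le2 le3.
  have := ler_wpM2l q0 le3.
  have : q * (e / 2) <= e / 2 by rewrite ler_piMl // ltW.
  nra.
move=> m; apply: cvg_of_small_diameter => e e0.
have [p Hp] : exists p, 2 * B * q ^+ p <= e / 2.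
  have /cvgrPdist_le : (fun p => 2 * B * q ^+ p) @ \oo --> (2 * B * 0 : R).
    by apply: cvgMr; apply: cvg_expr; rewrite ger0_norm.
  move=> /(_ (e / 2)) [|N _ /(_ N)]; first by rewrite divr_gt0.
  move=> /(_ (leqnn N)) H; exists N.
  by rewrite (le_trans (ler_norm _)) // -normrN -[X in `|X|]add0r -[0](mulr0 (2 * B)).
have [|A UA HA] := diam p m (e / 2); first by rewrite divr_gt0.
exists A => // i j Ai Aj; rewrite (le_trans (HA _ _ Ai Aj)) //.
by rewrite [leRHS]splitr lerD2r.
Qed.

End ultrafilter.

(** If no [d] works, there are unit vectors with [T x - r x] tending to 0, and
    [approx_eigenvector_cvg] turns them into a unit eigenvector with eigenvalue at least 1. *)
Lemma resolvent_bounded_below :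
  (forall (r : R) x, 1 <= r -> T x = r *: x -> x = 0) ->
  exists2 d : R, 0 < d &
    forall r x, 1 <= r -> d * `|x| <= `|r *: x - T x|.
Proof.
move=> inj; apply: contrapT => nex.
have [M M0 TM] := continuous_linear_norm_le R X T Tc.
(* The parameter stays in a compact interval: [r = |r y| <= |T y| + |T y - r y| <= M + 1] for a unit
   vector [y]. *)
have ex (k : nat) : exists p : R * X, [/\ 1 <= p.1 <= M + 1, `|p.2| = 1 &
    `|T p.2 - p.1 *: p.2| <= k.+1%:R^-1].
  apply: contrapT => nk; apply: nex; exists k.+1%:R^-1; first by rewrite invr_gt0.
  move=> r x r1; rewrite leNgt; apply/negP => lt_x; apply: nk.
  have x0 : 0 < `|x|.
    rewrite normr_gt0; apply/eqP => x0.
    by move: lt_x; rewrite x0 normr0 mulr0 ltNge normr_ge0.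
  have y1 : `|(`|x|^-1 *: x)| = 1 by rewrite normrZ normfV normr_id mulVf ?gt_eqF.
  have le_k : `|T (`|x|^-1 *: x) - r *: (`|x|^-1 *: x)| <= k.+1%:R^-1.
    rewrite linearZ /= scalerA mulrC -scalerA -scalerBr normrZ normfV normr_id.
    by rewrite distrC mulrC ler_pdivrMr // ltW.
  exists (r, `|x|^-1 *: x) => /=; split => //; rewrite r1 /=.
  set y := _ *: x in y1 le_k.
  have rE : r = `|r *: y| by rewrite normrZ y1 mulr1 ger0_norm // (le_trans _ r1).
  rewrite rE -[r *: y](subKr (T y)) (le_trans (ler_normB _ _)) // lerD //.
    by rewrite (le_trans (TM y)) // y1 mulr1.
  by rewrite (le_trans le_k) // invf_le1 // ler1n.
have [p pP] := choice ex.
have [U [UU Uoo]] := ultraFilterLemma (eventually_filter : ProperFilter \oo).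
have UP : ProperFilter U by exact: ultra_proper.
have [r Hr] : exists r : R, (fun k => (p k).1) @ U --> r.
  apply: (@ultra_compact_cvg _ U UU R `[1, M + 1]); first exact: segment_compact.
  by apply: nearW => k; rewrite /= in_itv /=; have [] := pP k.
have r1 : 1 <= r.
  apply: (closed_cvg _ (@closed_ge R 1) _ _ Hr).
  by apply: nearW => k; have [/andP[]] := pP k.
have Tp0 : (fun k => T (p k).2 - (p k).1 *: (p k).2) @ U --> (0 : X).
  apply: (cvg_trans (G := (fun k => T (p k).2 - (p k).1 *: (p k).2) @ \oo)).
    by move=> A /Uoo.
  apply/cvgrPdist_le => e e0.
  near=> k; rewrite sub0r normrN; have [_ _ /le_trans] := pP k; apply.
  near: k; have := @cvg_harmonic R => /cvgrPdist_le /(_ e e0).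
  by apply: filterS => k; rewrite /= sub0r normrN ger0_norm.
have pB : \forall k \near U, `|(p k).2| <= 1.
  by apply: nearW => k; have [_ ->] := pP k.
have [l Hl] := approx_eigenvector_cvg nat U UU _ _ r 1 0 r1 Hr pB Tp0.
have l1 : `|l| = 1.
  have : (fun k => `|(p k).2|) @ U --> `|l| by exact: cvg_norm.
  rewrite (_ : (fun k => _) = cst 1); last first.
    by apply/funext => k; have [_ ->] := pP k.
  have c1 : cst (1 : R) @ U --> (1 : R) by exact: cvg_cst.
  by move=> l1; exact: (cvg_unique (@norm_hausdorff _ R) l1 c1).
have /eqP : l = 0; last by rewrite -normr_eq0 l1 oner_eq0.
apply: inj r1 _; apply/eqP; rewrite -subr_eq0; apply/eqP.
have Tl : (fun k => T (p k).2 - (p k).1 *: (p k).2) @ U --> T l - r *: l.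
  by apply: cvgB; [exact: (cvg_comp _ _ Hl (Tc l))|exact: cvgZ].
exact: (cvg_unique (@norm_hausdorff _ X) Tl Tp0).
Unshelve. all: by end_near. Qed.

(** * Positivity of the resolvent by continuation in the parameter *)

Variable C : set X.
Hypotheses (Ccone : is_cone C) (CT : positive_op C T).

(** Injectivity is kept apart, so that solutions can be produced by a fixed point argument for one
    [y] at a time. *)
Definition positive_resolvent (r : R) := forall y, exists x,
  r *: x - T x = y /\ (C y -> C x).

Let coneD x y : C x -> C y -> C (x + y).
Proof.
have [_ _ CD _] := Ccone => Cx Cy.
by have := CD 1 1 x y ler01 ler01 Cx Cy; rewrite !scale1r.
Qed.

Let coneZ a x : 0 <= a -> C x -> C (a *: x).
Proof.
have [_ _ CD _] := Ccone => a0 Cx.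
by have := CD a 0 x x a0 (lexx _) Cx Cx; rewrite scale0r addr0.
Qed.

Lemma cone_fixed_point (y : X) (F : X -> X) (c : R) : c < 1 ->
  (forall x x', `|F x - F x'| <= c * `|x - x'|) ->
  (C y -> forall x, C x -> C (F x)) ->
  exists x, F x = x /\ (C y -> C x).
Proof.
move=> c1 Fc FC; have [C0 Ccl _ _] := Ccone.
have [Cy|nCy] := pselect (C y).
  have [x Cx xE] := banach_fixed_point_in C F c Ccl C0 (FC Cy) c1 Fc.
  by exists x.
have [|x _ xE] := banach_fixed_point_in setT F c closedT _ (fun _ => id) c1 Fc.
  by exists 0.
by exists x.
Qed.

Lemma positive_resolvent_large (M r : R) : 0 < M ->
  (forall x, `|T x| <= M * `|x|) -> M < r -> positive_resolvent r.
Proof.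
move=> M0 TM Mr y; have r0 : 0 < r by exact: lt_trans Mr.
have [|x x'|Cy x Cx|x [xE Cx]] :=
    cone_fixed_point y (fun x => r^-1 *: (y + T x)) (r^-1 * M).
- by rewrite mulrC ltr_pdivrMr // mul1r.
- rewrite -scalerBr opprD addrACA subrr add0r -linearB normrZ.
  by rewrite gtr0_norm ?invr_gt0 // -mulrA ler_wpM2l // invr_ge0 ltW.
- by apply: coneZ; [rewrite invr_ge0 ltW|apply: coneD => //; exact: CT].
exists x; split=> //.
by rewrite -{1}xE scalerA mulfV ?gt_eqF // scale1r addrK.
Qed.

(** The equation [s x - T x = y] becomes [x = S (y + (r - s) x)] with [S] a right inverse of
    [r - T]. The lower bound makes [S] Lipschitz with constant [1 / d], and [r - s <= d / 2] then
    gives the contraction constant [1 / 2]. *)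
Lemma positive_resolvent_step (d r s : R) : 0 < d ->
  (forall x, d * `|x| <= `|r *: x - T x|) -> positive_resolvent r ->
  0 <= r - s <= d / 2 -> positive_resolvent s.
Proof.
move=> d0 low Pr /andP[rs0 rsd] y.
have [S SP] := choice Pr.
have SL u v : `|S u - S v| <= d^-1 * `|u - v|.
  rewrite mulrC ler_pdivlMr // mulrC (le_trans (low _)) // scalerBr.
  by rewrite [T _]linearB opprD addrACA -opprD (SP u).1 (SP v).1.
have [|x x'|Cy x Cx|x [xE Cx]] :=
    cone_fixed_point y (fun x => S (y + (r - s) *: x)) (2^-1).
- by rewrite invf_lt1 // ltr1n.
- apply: le_trans (SL _ _) _; rewrite opprD addrACA subrr add0r -scalerBr normrZ.
  rewrite mulrA ler_wpM2r // ger0_norm // mulrC ler_pdivrMr //.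
  by rewrite mulrC.
- apply: (SP _).2; apply: coneD => //; exact: coneZ.
exists x; split=> //.
have := (SP (y + (r - s) *: x)).1; rewrite xE scalerBl => /eqP.
rewrite subr_eq addrAC addrA -subr_eq opprK addrC addrA.
by rewrite -addrA (inj_eq (addrI _)) -subr_eq => /eqP.
Qed.

Lemma positive_resolvent1 :
  (forall (r : R) x, 1 <= r -> T x = r *: x -> x = 0) -> positive_resolvent 1.
Proof.
move=> inj.
have [d d0 low] := resolvent_bounded_below inj.
have [M M0 TM] := continuous_linear_norm_le R X T Tc.
have d2 : 0 < d / 2 by rewrite divr_gt0.
suff down (k : nat) :
    positive_resolvent (1 + (d / 2) *+ k) -> positive_resolvent 1.
  have [k kM] : exists k : nat, M < (d / 2) *+ k.
    exists (Num.truncn (M / (d / 2))).+1.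
    rewrite -mulr_natl -ltr_pdivrMr //; exact: truncnS_gt.
  apply: (down k); apply: positive_resolvent_large M0 TM _.
  by rewrite (lt_trans kM) // ltrDr.
elim: k => [|k IH]; first by rewrite mulr0n addr0.
move=> Pk; apply: IH; apply: positive_resolvent_step d0 _ Pk _.
  by move=> x; apply: low; rewrite lerDl mulrn_wge0 // ltW.
by rewrite mulrS opprD addrACA subrr add0r addrK lexx ltW.
Qed.


(** * Operator norms of the powers *)

(** At [x = 0] the quotient is 0 by the convention [0^-1 = 0], so the set is nonempty even on the
    zero space. *)
Definition iter_norm (k : nat) : R :=
  sup [set `|iter k T x| / `|x| | x in [set: X]].

Lemma iter_norm_has_sup k : has_sup [set `|iter k T x| / `|x| | x in [set: X]].
Proof.
have [M M0 TM] := continuous_linear_norm_le R X T Tc.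
have TMk x : `|iter k T x| <= M ^+ k * `|x|.
  elim: k => [|k IH]; first by rewrite expr0 mul1r.
  by rewrite iterS exprS -mulrA (le_trans (TM _)) // ler_wpM2l // ltW.
split; first by exists (`|iter k T 0| / `|(0 : X)|); exists 0.
exists (M ^+ k) => _ [x _ <-].
have [->|x0] := eqVneq x 0; first by rewrite normr0 invr0 mulr0 exprn_ge0 // ltW.
by rewrite ler_pdivrMr ?normr_gt0.
Qed.

Lemma iter_norm_le k x : `|iter k T x| <= iter_norm k * `|x|.
Proof.
have [->|x0] := eqVneq x 0.
  have := iter_linearZ k 0 0; rewrite !scale0r => ->.
  by rewrite normr0 mulr0.
rewrite -ler_pdivrMr ?normr_gt0 //; apply: ub_le_sup.
  by case: (iter_norm_has_sup k).
by exists x.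
Qed.

Lemma iter_norm_near k (th : R) : th < 1 -> 0 < iter_norm k ->
  exists2 z, `|z| <= 2^-1 & th / 2 * iter_norm k <= `|iter k T z|.
Proof.
move=> th1 a0.
have e0 : 0 < iter_norm k * (1 - th) by rewrite mulr_gt0 // subr_gt0.
have [_ [x _ <-] /ltW] := sup_adherent e0 (iter_norm_has_sup k).
rewrite -/(iter_norm k) => le_x.
exists ((2 * `|x|)^-1 *: x).
  rewrite normrZ normfV normrM normr_id normr_nat invfM -mulrA.
  have [->|x0] := eqVneq x 0; first by rewrite normr0 !mulr0.
  by rewrite mulVf ?normr_eq0 // mulr1.
rewrite iter_linearZ normrZ normfV normrM normr_id normr_nat invfM.
by lra.
Qed.

Hypothesis Ctot : total_cone C.

(** * A subeigenvector in the cone from non-decaying powers *)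

Section growth.
Variables (U : set_system nat) (UU : UltraFilter U) (Uoo : \oo `<=` U).
Let UP : ProperFilter U := ultra_proper.
#[local] Existing Instance UP.
Let t (j : nat) : R := 1 + j.+1%:R^-1.
Let a := iter_norm.
Variable k : nat -> nat.
Hypothesis (a1 : forall i, 1 <= a i) (kj : forall j, (j <= k j)%N).
Hypothesis kt : forall j, j.+1%:R <= a (k j) * t j ^+ k j.
Hypothesis kmax : forall j m, (m <= k j)%N -> a (k j - m)%N <= a (k j) * t j ^+ m.

Let a0 i : 0 < a i. Proof. exact: lt_le_trans (a1 i). Qed.

Let tX_cvg m : (fun j => t j ^+ m) @ U --> (1 : R).
Proof.
suff tm : (fun j => t j ^+ m) @ \oo --> (1 : R) by move=> A /tm /Uoo.
rewrite -(expr1n R m).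
elim: m => [|m IH].
  by rewrite (_ : (fun j => _) = cst 1); [exact: cvg_cst|apply/funext => j].
under eq_fun do rewrite exprS; rewrite exprS; apply: cvgM => //.
rewrite -[X in _ --> X]addr0; apply: cvgD; first exact: cvg_cst.
exact: cvg_harmonic.
Qed.

Let near_le m : \forall j \near U, (m <= k j)%N.
Proof. by apply: Uoo; exists m => // j /= /leq_trans; apply. Qed.

Let tX_le2 m : \forall j \near U, t j ^+ m <= 2.
Proof.
move/cvgrPdist_le: (tX_cvg m) => /(_ 1 ltr01); apply: filterS => j.
by rewrite ler_distl => /andP[]; lra.
Qed.

Let near_iter m : \forall j \near U,
  forall x, `|iter (k j - m) T x| <= 2 * a (k j) * `|x|.
Proof.
apply: filterS2 (tX_le2 m) (near_le m) => j t2 mk x.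
rewrite (le_trans (iter_norm_le _ _)) // ler_wpM2r // (le_trans (kmax _ _ mk)) //.
by rewrite mulrC ler_wpM2r // ltW.
Qed.

Lemma positive_orbit_lower_bound : exists c u, [/\ 0 < c, C u &
  \forall j \near U, c * a (k j) <= `|iter (k j - n) T u|].
Proof.
(* In units of [a (k j)]: the near-maximizer gives [(3 + q) / 8], the part [T ^ n - K] takes at most
   [(1 + q) / 4], and exactly [c] remains. Replacing [K z] by [y] and [y] by [u - v] costs [c / 2]
   and [c / 4], so [u] or [v] keeps at least [c / 8]. *)
pose c := (1 - q) / 8.
have c0 : 0 < c by rewrite divr_gt0 // subr_gt0.
have th1 : (3 + q) / 4 < 1 by rewrite ltr_pdivrMr //; move: q1; lra.
have ex j : exists z, `|z| <= 2^-1 /\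
    (3 + q) / 4 / 2 * a (k j) <= `|iter (k j) T z|.
  by have [z] := iter_norm_near (k j) _ th1 (a0 _); exists z.
have [z zP] := choice ex.
have zB : \forall j \near U, `|z j| <= 2^-1 by apply: nearW => j; case: (zP j).
have [y Ky] := compact_op_cvg U UU K z _ Kc zB.
have [_ [[u Cu [v Cv <-]] yuv]] :
    [set x - y | x in C & y in C] `&` ball y (c / 8) !=set0.
  have yC : closure [set x - y | x in C & y in C] y by rewrite Ctot.
  by apply: yC; apply: nbhsx_ballx; rewrite divr_gt0.
have {}yuv : `|y - (u - v)| <= c / 8.
  by move: yuv; rewrite -ball_normE /ball_ /= => /ltW.
have qt : \forall j \near U, q * t j ^+ n <= (1 + q) / 2.
  have : (fun j => q * t j ^+ n) @ U --> q * 1 by apply: cvgMr; exact: tX_cvg.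
  have e0 : 0 < (1 - q) / 2 by rewrite divr_gt0 // subr_gt0.
  move=> /cvgrPdist_le /(_ _ e0); apply: filterS => j.
  by rewrite ler_distl => /andP[]; lra.
have Kzy : \forall j \near U, `|y - K (z j)| <= c / 4.
  by move/cvgrPdist_le: Ky; apply; rewrite divr_gt0.
have uv : \forall j \near U,
    c / 8 * a (k j) <= `|iter (k j - n) T u| \/
    c / 8 * a (k j) <= `|iter (k j - n) T v|.
  near=> j.
  have nk : (n <= k j)%N by near: j; exact: near_le.
  have itB : forall x, `|iter (k j - n) T x| <= 2 * a (k j) * `|x|.
    by near: j; exact: near_iter.
  have qtj : q * t j ^+ n <= (1 + q) / 2 by near: j.
  have Kzj : `|y - K (z j)| <= c / 4 by near: j.
  have [zj zk] := zP j.
  set A := iter (k j - n) T in itB *.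
  have zE : iter (k j) T (z j) = A (iter n T (z j)) by rewrite /A -iterD subnK.
  have split_z : iter (k j) T (z j) = A (iter n T (z j) - K (z j)) -
      A (y - K (z j)) + A (y - (u - v)) + A u - A v.
    by rewrite zE /A !iter_linearB opprB !subrKA -addrA subrK.
  have l1 : `|A (iter n T (z j) - K (z j))| <= (1 + q) / 4 * a (k j).
    rewrite (le_trans (iter_norm_le _ _)) //.
    rewrite (le_trans (ler_wpM2l (ltW (a0 _)) (Aq _))) //.
    have le2 : a (k j - n)%N * (q * `|z j|) <= a (k j) * t j ^+ n * (q * 2^-1).
      apply: ler_pM; rewrite ?mulr_ge0 //; first exact: ltW.
        exact: kmax.
      exact: ler_wpM2l.
    rewrite (le_trans le2) //.
    have := ler_wpM2l (ltW (a0 (k j))) qtj; lra.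
  have l2 := itB (y - K (z j)).
  have l3 := itB (y - (u - v)).
  have aj := a0 (k j).
  have l2' := ler_wpM2l (ltW aj) Kzj.
  have l3' := ler_wpM2l (ltW aj) yuv.
  have tri : `|iter (k j) T (z j)| <= `|A (iter n T (z j) - K (z j))| +
      `|A (y - K (z j))| + `|A (y - (u - v))| + `|A u| + `|A v|.
    by rewrite split_z; do ![apply: le_trans (ler_normB _ _) _; rewrite lerD2r
                         |apply: le_trans (ler_normD _ _) _; rewrite lerD2r].
  have [?|lt_u] := leP (c / 8 * a (k j)) `|A u|; first by left.
  by right; rewrite /c in lt_u l2' l3' *; lra.
(* Which of [u] and [v] works may depend on [j]; the ultrafilter selects one of them. *)
have [Uu|nUu] := in_ultra_setVsetC
    [set j | c / 8 * a (k j) <= `|iter (k j - n) T u|] UU.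
  by exists (c / 8), u; rewrite divr_gt0.
exists (c / 8), v; rewrite divr_gt0 //; split=> //.
by apply: filterS2 uv nUu => j [].
Unshelve. all: by end_near. Qed.

(* The sum of the [s ^ (m - i) *: iter i T u] for [i <= m]. *)
Fixpoint weighted_orbit (s : R) (u : X) (m : nat) : X :=
  if m is m'.+1 then s *: weighted_orbit s u m' + iter m T u else u.

(** The sum telescopes under [T - s], leaving only its two end terms. *)
Lemma weighted_orbitE s u m :
  T (weighted_orbit s u m) - s *: weighted_orbit s u m =
  iter m.+1 T u - s ^+ m.+1 *: u.
Proof.
elim: m => [//|m IH]; rewrite [weighted_orbit _ _ _]/=.
rewrite [T (_ + _)]linearD linearZ scalerDr opprD addrACA -scalerBr IH.
by rewrite scalerBr scalerA -exprS addrC addrA /= subrK.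
Qed.

Lemma weighted_orbit_cone s u m : 0 <= s -> C u ->
  C (weighted_orbit s u m) /\ C (weighted_orbit s u m - iter m T u).
Proof.
move=> s0 Cu.
have Ci i : C (iter i T u) by elim: i => //= i; exact: CT.
elim: m => [|m [IH _]] /=.
  by rewrite subrr; split=> //; have := coneZ 0 u (lexx 0) Cu; rewrite scale0r.
by rewrite addrK; split; [apply: coneD; [exact: coneZ|exact: (Ci m.+1)]|exact: coneZ].
Qed.

Lemma subeigenvector_of_growth : exists x, [/\ C x, x <> 0 & C (T x - x)].
Proof.
have [_ Ccl _ Csal] := Ccone.
have [c [u [c0 Cu cu]]] := positive_orbit_lower_bound.
have Ci i : C (iter i T u) by elim: i => //= i; exact: CT.
(* Increasing [m] by 1 moves [n] steps back along the orbit, the form required by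
   [backward_orbit_cvg]. *)
pose w m j := (a (k j))^-1 *: iter (k j - n - m * n) T u.
have wB m : \forall j \near U, `|w m j| <= 2 * `|u|.
  apply: filterS (near_iter (n + m * n)) => j /(_ u).
  rewrite /w normrZ gtr0_norm ?invr_gt0 // subnDA => le_u.
  by rewrite mulrC ler_pdivrMr // mulrAC.
have wT m : \forall j \near U, w m j = iter n T (w m.+1 j).
  (* Subtraction is truncated, so the exponents match only once [k j] is large. *)
  apply: filterS (near_le (n + m.+1 * n)) => j nk.
  rewrite /w iter_linearZ -iterD; congr (_ *: iter _ T u); lia.
have [l0 wl0] := backward_orbit_cvg _ U UU w _ wB wT 0%N.
have Cw : C l0.
  apply: (closed_cvg C Ccl _ _ wl0); apply: nearW => j.
  by apply: coneZ => //; rewrite invr_ge0 ltW.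
have nw : c <= `|l0|.
  apply: (closed_cvg _ (@closed_ge R c) _ _ (cvg_norm wl0)).
  apply: filterS cu => j cu /=; rewrite /w mul0n subn0 normrZ.
  by rewrite gtr0_norm ?invr_gt0 // mulrC ler_pdivlMr.
pose s j := (t j)^-1.
have t0 j : 0 < t j by rewrite addr_gt0.
have s0 j : 0 < s j by rewrite invr_gt0.
have s1 : s @ U --> (1 : R).
  rewrite -[1]invr1; apply: cvgV; first exact: oner_neq0.
  exact: (tX_cvg 1).
pose x j := (a (k j))^-1 *: weighted_orbit (s j) u (k j - n).
have Cx j : C (x j).
  apply: coneZ; first by rewrite invr_ge0 ltW.
  exact: (weighted_orbit_cone _ _ _ (ltW (s0 j)) Cu).1.
have Cxw j : C (x j - w 0%N j).
  rewrite /x /w mul0n subn0 -scalerBr; apply: coneZ.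
    by rewrite invr_ge0 ltW.
  exact: (weighted_orbit_cone _ _ _ (ltW (s0 j)) Cu).2.
(* The [x j] may be unbounded. Scaling by [ta] gives norm [1 - ta], and the limit [tau] may be 0. *)
pose ta j := (1 + `|x j|)^-1.
have ta0 j : 0 < ta j by rewrite invr_gt0 ltr_wpDr.
have [tau Htau] : exists tau : R, ta @ U --> tau.
  apply: (@ultra_compact_cvg _ U UU R `[0, 1]); first exact: segment_compact.
  apply: nearW => j; rewrite /= in_itv /=; apply/andP; split; first exact: ltW.
  by rewrite invf_le1 ?lerDl // ltr_wpDr.
have nx j : `|ta j *: x j| = 1 - ta j.
  rewrite normrZ gtr0_norm // /ta.
  have d0 : 1 + `|x j| != 0 by rewrite gt_eqF // ltr_wpDr.
  by field.
(* This equals [s t ^ n / (a t ^ k)], eventually at most [2 / (j + 1)] by the choice of [k j]. *)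
pose rest j : R := s j ^+ (k j - n).+1 / a (k j).
have rest0 : rest @ U --> (0 : R).
  have r2 : (fun j => 2 * j.+1%:R^-1) @ U --> (2 * 0 : R).
    apply: cvgMr => A hA; apply: Uoo; exact: (@cvg_harmonic R A hA).
  rewrite mulr0 in r2; apply: squeeze_cvgr r2; last exact: cvg_cst.
  apply: filterS2 (tX_le2 n) (near_le n) => j t2 nk.
  have s0' : 0 <= s j by exact: ltW.
  have a0' : 0 <= a (k j) by exact: ltW.
  apply/andP; split; first by rewrite divr_ge0 ?exprn_ge0.
  rewrite /rest exprS -mulrA.
  have sj1 : s j <= 1 by rewrite invf_le1 // lerDl.
  have r0 : 0 <= s j ^+ (k j - n) / a (k j) by rewrite divr_ge0 ?exprn_ge0.
  rewrite (le_trans (ler_piMl r0 sj1)) //.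
  have -> : s j ^+ (k j - n) / a (k j) = t j ^+ n * (a (k j) * t j ^+ k j)^-1.
    rewrite -[in t j ^+ k j](subnK nk) exprD /s exprVn !invfM.
    rewrite [RHS]mulrCA [_ * (_ ^-1 * _)]mulrCA mulfV ?mulr1 1?mulrC //.
    by rewrite gt_eqF // exprn_gt0.
  have t0' : 0 <= t j by exact: ltW.
  apply: ler_pM => //; rewrite ?invr_ge0 ?mulr_ge0 ?exprn_ge0 //.
  by rewrite lef_pV2 ?posrE ?mulr_gt0 ?exprn_gt0.
have xB : \forall j \near U, `|ta j *: x j| <= 1.
  by apply: nearW => j; rewrite nx gerBl ltW.
have Tx : (fun j => T (ta j *: x j) - s j *: (ta j *: x j)) @ U -->
    tau *: (T l0 - 0 *: u).
  rewrite (_ : (fun j => _) = fun j => ta j *: (T (w 0%N j) - rest j *: u)).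
    apply: cvgZ => //; apply: cvgB; first exact: (cvg_comp _ _ wl0 (Tc l0)).
    exact: cvgZr_tmp.
  apply/funext => j.
  have Tsub b y : T (b *: y) - s j *: (b *: y) = b *: (T y - s j *: y).
    by rewrite scalerBr !scalerA [b * _]mulrC [T _]linearZ.
  rewrite !Tsub weighted_orbitE; congr (_ *: _).
  by rewrite scalerBr scalerA /rest mulrC /w mul0n subn0 [T (_ *: _)]linearZ.
rewrite scale0r subr0 in Tx.
have [l xl] := approx_eigenvector_cvg _ U UU _ s 1 1 _ (lexx 1) s1 xB Tx.
have Cl : C l.
  apply: (closed_cvg C Ccl _ _ xl); apply: nearW => j.
  by apply: coneZ => //; exact: ltW.
have Clw : C (l - tau *: l0).
  have lw : (fun j => ta j *: x j - ta j *: w 0%N j) @ U --> l - tau *: l0.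
    by apply: cvgB => //; exact: cvgZ.
  apply: (closed_cvg C Ccl _ _ lw); apply: nearW => j.
  by rewrite -scalerBr; apply: coneZ => //; exact: ltW.
have tau0 : 0 <= tau.
  apply: (closed_cvg _ (@closed_ge R 0) _ _ Htau).
  by apply: nearW => j /=; exact: ltW.
have Tl : T l - l = tau *: T l0.
  have Tl : (fun j => T (ta j *: x j) - s j *: (ta j *: x j)) @ U -->
      T l - 1 *: l.
    by apply: cvgB; [exact: (cvg_comp _ _ xl (Tc l))|exact: cvgZ].
  rewrite scale1r in Tl.
  exact: (cvg_unique (@norm_hausdorff _ X) Tl Tx).
have nl : `|l| = 1 - tau.
  have n1 : (fun j => `|ta j *: x j|) @ U --> `|l| by exact: cvg_norm.
  have n2 : (fun j => `|ta j *: x j|) @ U --> 1 - tau.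
    under eq_fun do rewrite nx.
    by apply: cvgB => //; exact: cvg_cst.
  exact: (cvg_unique (@norm_hausdorff _ R) n1 n2).
exists l; split=> //; last by rewrite Tl; apply: coneZ => //; exact: CT.
(* If [l = 0], then [tau = 1] and [- l0] lies in the cone, so [l0 = 0], against [|l0| >= c]. *)
move=> l00; move: nl; rewrite l00 normr0 => /eqP.
rewrite eq_sym subr_eq0 => /eqP tau1.
move: Clw; rewrite l00 -tau1 scale1r sub0r => /(Csal _ Cw) w0.
by move: nw; rewrite w0 normr0 leNgt c0.
Qed.

End growth.

Lemma iter_norm_ge1_subeigenvector : (forall k, 1 <= iter_norm k) ->
  exists x, [/\ C x, x <> 0 & C (T x - x)].
Proof.
move=> a1.
have [k kP] := choice (fun j => exists_growth_index iter_norm j a1).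
have [U [UU Uoo]] := ultraFilterLemma (eventually_filter : ProperFilter \oo).
apply: (subeigenvector_of_growth U UU Uoo k a1) => j; first by case: (kP j).
  by case: (kP j).
by case: (kP j) => _ _; apply.
Qed.

Lemma small_gain_power_contraction :
  (forall x, C x -> x <> 0 -> ~ C (T x - x)) ->
  exists N c, [/\ (0 < N)%N, 0 <= c, c < 1 &
    forall x, `|iter N T x| <= c * `|x|].
Proof.
move=> sg.
have [k ak] : exists k, iter_norm k < 1.
  apply: contrapT => nk.
  have [k|x [Cx x0 CTx]] := iter_norm_ge1_subeigenvector.
    by rewrite leNgt; apply/negP => ak; apply: nk; exists k.
  exact: (sg x).
(* At exponent 0 the norm is that of the identity; it is below 1 only on the zero space, where
   exponent 1 works. *)
case: k ak => [|k] ak; last first.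
  exists k.+1, (Num.max (iter_norm k.+1) 0).
  split=> // [||x]; first by rewrite le_max lexx orbT.
    by rewrite gt_max ak ltr01.
  by rewrite (le_trans (iter_norm_le _ _)) // ler_wpM2r // le_max lexx.
have X0 (x : X) : x = 0.
  apply/eqP; rewrite -normr_le0 leNgt; apply/negP => x0.
  by have := iter_norm_le 0 x; rewrite leNgt gtr_pMl // ak.
by exists 1%N, 0; split=> // x; rewrite [iter _ _ _]X0 normr0 mul0r.
Qed.

End quasi_compact_operator.

(** * Consequences of a contracting power *)

Lemma power_contraction_iter (R : realType) (X : normedModType R)
    (T : {linear X -> X}) (N : nat) (c : R) : 0 <= c ->
  (forall x, `|iter N T x| <= c * `|x|) ->
  forall m x, `|iter (m * N) T x| <= c ^+ m * `|x|.
Proof.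
move=> c0 TN; elim=> [|m IH] x; first by rewrite expr0 mul1r.
rewrite mulSn iterD exprS -mulrA.
by rewrite (le_trans (TN _)) // ler_wpM2l.
Qed.

Lemma power_contraction_cvg (R : realType) (X : normedModType R)
    (T : {linear X -> X}) (N : nat) (c : R) : (0 < N)%N -> 0 <= c -> c < 1 ->
  (forall x, `|iter N T x| <= c * `|x|) ->
  forall x, (fun k => iter k T x) @ \oo --> (0 : X).
Proof.
move=> N0 c0 c1 TN x.
pose B := \sum_(r < N) `|iter r T x|.
have le_B k : `|iter k T x| <= c ^+ (k %/ N) * B.
  rewrite {1}(divn_eq k N) iterD.
  rewrite (le_trans (power_contraction_iter _ _ T N c c0 TN _ _)) //.
  rewrite ler_wpM2l ?exprn_ge0 // /B (bigD1 (Ordinal (ltn_pmod k N0))) //=.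
  by rewrite lerDl; exact: sumr_ge0.
have cB : (fun m => c ^+ m * B) @ \oo --> (0 * B : R).
  by apply: cvgMl; apply: cvg_expr; rewrite ger0_norm.
rewrite mul0r in cB.
apply/cvgrPdist_le => e e0; move/cvgrPdist_le: cB => /(_ e e0) [m _ Hm].
exists (m * N)%N => // k /= mk; rewrite sub0r normrN (le_trans (le_B k)) //.
have := Hm (k %/ N)%N; rewrite /= leq_divRL // => /(_ mk).
by rewrite sub0r normrN; apply: le_trans; exact: ler_norm.
Qed.

(** A supremum of moduli below 1 could equal 1, hence the uniform bound [1 - h]. *)
Lemma power_contraction_spectral_radius_lt1 (R : realType)
    (X : completeNormedModType R) (T : {linear X -> X}) (N : nat) (c : R) :
  (0 < N)%N -> 0 <= c -> c < 1 -> (forall x, `|iter N T x| <= c * `|x|) ->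
  spectral_radius T < 1.
Proof.
move=> N0 c0 c1 TN.
(* The bound [1 / 4] leaves [1 / 2] after the factor 2 of the complexification. *)
have [m m0 cm] : exists2 m, (0 < m)%N & c ^+ m <= 4^-1.
  have /cvgrPdist_le : (fun m => c ^+ m) @ \oo --> (0 : R).
    by apply: cvg_expr; rewrite ger0_norm.
  move=> /(_ 4^-1); rewrite invr_gt0 ltr0n => /(_ erefl) [m _ Hm].
  exists m.+1 => //; have := Hm m.+1 (leqnSn m).
  by rewrite /= sub0r normrN; apply: le_trans; exact: ler_norm.
pose M := (m * N)%N.
have M0 : (0 < M)%N by rewrite muln_gt0 m0.
have TM x : `|iter M T x| <= 4^-1 * `|x|.
  rewrite (le_trans (power_contraction_iter _ _ T N c c0 TN m x)) //.
  by rewrite ler_wpM2r.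
(* By Bernoulli [(1 - h) ^ M >= 1 / 2], so a modulus above [1 - h] has [M]-th power above
   [2 * 4^-1]. *)
pose h : R := (2 * M%:R)^-1.
have h0 : 0 < h by rewrite invr_gt0 mulr_gt0 // ltr0n.
suff ub : ubound [set r : R | exists a b : R,
    in_spectrumC T a b /\ r = Num.sqrt (a ^+ 2 + b ^+ 2)] (1 - h).
  rewrite /spectral_radius; set S := [set r | _] in ub *.
  (* An empty spectrum is covered by the convention that [sup] of the empty set is 0. *)
  have [->|/set0P S0] := eqVneq S set0; first by rewrite sup0.
  by rewrite (le_lt_trans (ge_sup S0 ub)) // gtrBl.
move=> r [a [b [sp ->]]]; rewrite leNgt; apply/negP => lt_r.
apply: (norm_iter_notin_spectrumC _ _ _ _ _ _ _ M0 TM _ _ sp).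
  by rewrite invr_ge0.
have h1 : h <= 1.
  have M1 : 1 <= M%:R :> R by rewrite ler1n.
  rewrite invf_le1; first by lra.
  by rewrite mulr_gt0 // ltr0n.
have hM : h *+ M = 2^-1.
  by rewrite -[LHS]mulr_natr /h invfM mulfVK // pnatr_eq0 -lt0n.
have := bernoulli_ineq (- h) M; rewrite lerN2 => /(_ h1).
rewrite mulNrn hM => bern.
have : (1 - h) ^+ M < Num.sqrt (a ^+ 2 + b ^+ 2) ^+ M.
  by rewrite ltr_pXn2r // nnegrE ?subr_ge0 ?sqrtr_ge0.
by move: bern; lra.
Qed.

(** * Links between the spectral radius, the iterates and the small-gain condition *)

Lemma spectral_radius_lt1_injective (R : realType) (X : completeNormedModType R)
    (T : {linear X -> X}) : continuous T -> spectral_radius T < 1 ->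
  forall (r : R) x, 1 <= r -> T x = r *: x -> x = 0.
Proof.
move=> Tc rT r x r1 Tx; apply: contrapT => x0.
have [M M0 TM] := continuous_linear_norm_le R X T Tc.
have : r <= spectral_radius T; last by rewrite leNgt (lt_le_trans rT r1).
apply: ub_le_sup.
  (* Membership bounds [sup] only for a set bounded above; [2 M] comes from exponent 1. *)
  exists (2 * M) => _ [a [b [sp ->]]]; rewrite leNgt; apply/negP => lt_M.
  by apply: (norm_iter_notin_spectrumC R X T 1 M a b _ TM (ltW M0) _ sp).
exists r, 0; split; last first.
  by rewrite expr0n addr0 sqrtr_sqr ger0_norm // (le_trans _ r1).
move=> /bij_inj /(_ (x, 0) (0, 0)) /=.
rewrite !(scaler0, linear0, subr0, scale0r, addr0, Tx, subrr) => /(_ erefl).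
by case.
Qed.

(** From [T x >= x] follows [T ^ k x >= x] for all [k]. Some [T ^ k x] is arbitrarily small, so
    [- x] is a limit of cone elements [T ^ k x - x], and [x = 0]. *)
Lemma inf_iter0_small_gain (R : realType) (X : normedModType R) (C : set X)
    (T : {linear X -> X}) : is_cone C -> positive_op C T ->
  (forall x, C x -> inf [set `|iter k T x| | k in [set: nat]] = 0) ->
  forall x, C x -> x <> 0 -> ~ C (T x - x).
Proof.
move=> [_ Ccl CD Csal] CT infT x Cx x0 CTx; apply: x0; apply: Csal => //.
have Ck k : C (iter k T x - x).
  elim: k => [|k IH].
    by have := CD 0 0 x x (lexx 0) (lexx 0) Cx Cx; rewrite subrr !scale0r addr0.
  rewrite iterS -(subrKA (T x)) -linearB.
  have := CD 1 1 _ _ ler01 ler01 (CT _ IH) CTx.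
  by rewrite !scale1r.
apply: Ccl => B /nbhs_ballP [e /= e0 eB].
have hi : has_inf [set `|iter k T x| | k in [set: nat]].
  split; first by exists `|iter 0 T x|; exists 0%N.
  by exists 0 => _ [k _ <-].
have [_ [k _ <-]] := inf_adherent e0 hi.
rewrite infT // add0r => lt_e.
exists (iter k T x - x); split=> //; apply: eB.
by rewrite -ball_normE /ball_ /= opprB addKr normrN.
Qed.

Theorem theorem3p14 (R : realType) (X : completeNormedModType R) (C : set X)
  (T : {linear X -> X}) :
  is_cone C -> total_cone C -> continuous T -> positive_op C T ->
  quasi_compact T ->
  [<-> spectral_radius T < 1;
       exists S : X -> X,
         [/\ cancel (fun x => x - T x) S, cancel S (fun x => x - T x)
           & forall y, C y -> C (S y)];
       forall x : X, C (x - T x) -> C x;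
       forall x : X, C x -> x <> 0 -> ~ C (T x - x);
       forall x : X, C x -> (fun k : nat => iter k T x) @ \oo --> (0 : X);
       forall x : X, C x -> inf [set `|iter k T x| | k in [set: nat]] = 0].
Proof.
move=> Ccone Ctot Tc CT [n [K [n0 [Kc [c c1 Ac]]]]].
(* The constant [c] may be negative when [X] is the zero space. *)
pose q := Num.max c 0.
have q0 : 0 <= q by rewrite le_max lexx orbT.
have q1 : q < 1 by rewrite gt_max c1 ltr01.
have Aq x : `|iter n T x - K x| <= q * `|x|.
  by rewrite (le_trans (Ac x)) // ler_wpM2r // le_max lexx.
(* Used twice: from (iv) to (v), and from (vi) to (i) by way of the small-gain condition. *)
have contr :=
  small_gain_power_contraction T n K q Tc Kc q0 q1 Aq C Ccone CT Ctot.
tfae.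
- move=> rT; have inj := spectral_radius_lt1_injective R X T Tc rT.
  have [S SP] :=
    choice (positive_resolvent1 T n K q Tc Kc q1 Aq C Ccone CT inj).
  have S1 y : S y - T (S y) = y by rewrite -[X in X - _]scale1r (SP y).1.
  exists S; split => // [x|y]; last exact: (SP y).2.
  apply/eqP; rewrite -subr_eq0; apply/eqP; apply: (inj 1) => //.
  rewrite scale1r linearB; apply/eqP; rewrite eq_sym -subr_eq0 opprD addrACA -opprD.
  by rewrite S1 subrr.
- by move=> [S [S1 S2 CS]] x /CS; rewrite S1.
- move=> iii x Cx x0 CTx; apply: x0; have [_ _ _] := Ccone; apply=> //.
  (* Assertion (iii) is applied to [- x], for which [- x - T (- x) = T x - x]. *)
  by apply: iii; rewrite linearN opprK addrC.
- move=> /contr [N [d [N0 d0 d1 TN]]] x _.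
  exact: power_contraction_cvg N0 d0 d1 TN x.
- move=> Tk x Cx; apply/eqP; rewrite eq_le; apply/andP; split.
    apply/ler_addgt0Pr => e e0; rewrite add0r.
    have /cvgrPdist_le /(_ e e0) [m _ /(_ m (leqnn m))] := Tk x Cx.
    rewrite /= sub0r normrN; apply: le_trans; apply: ge_inf.
      by exists 0 => _ [k _ <-].
    by exists m.
  apply: lb_le_inf; first by exists `|iter 0 T x|; exists 0%N.
  by move=> _ [k _ <-].
- move=> /(inf_iter0_small_gain R X C T Ccone CT) /contr [N [d [N0 d0 d1 TN]]].
  exact: power_contraction_spectral_radius_lt1 N0 d0 d1 TN.
Qed.
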